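(* Let $p$ be an odd prime and let $q$ be a power of $p$. Then \[ \sum_{k=0}^{q-1}\binom{2k}{k}x^k\equiv(1-4x)^{(q-1)/2}\pmod{p} \] as polynomials in the indeterminate $x$.
   Context: The congruence modulo $p$ is between polynomials in $\mathbb{Z}[x]$, meaning that corresponding coefficients are congruent modulo $p$ (equivalently, the two polynomials have equal images in $\mathbb{F}_p[x]$). A power of $p$ means $q=p^s$ with $s\ge 1$. *)

(* Defs.v *)
From mathcomp Require Import all_boot all_order all_algebra.

Set Implicit Arguments.
Unset Strict Implicit.
Unset Printing Implicit Defensive.

Import GRing.Theory.
Local Open Scope ring_scope.

Definition eqpoly_mod (m : nat) (f g : {poly int}) : Prop :=
  forall i : nat, (f`_i = g`_i %[mod m%:Z])%Z.

(* Main.v *)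
Require Import Defs.
From mathcomp Require Import all_boot all_order all_algebra.
From mathcomp Require Import zify ring.

(** Both sides are square roots of the same power series.  Over the integers,
    the generating series [F] of the central binomial coefficients satisfies
    [(1 - 4x) F^2 = 1]; coefficientwise this is the convolution identity
    [sum_central_bin], and it holds modulo [x^q] for the truncation of [F].
    Modulo [p], the Frobenius map gives the right-hand side
    [G = (1 - 4x)^((q-1)/2)] the same property, because
    [(1 - 4x) G^2 = (1 - 4x)^q = 1 - (4x)^q].
    Hence [x^q] divides [(1 - 4x)(F + G)(F - G)].  The first two factors have
    constant terms [1] and [2], so for odd [p] they are prime to [x], and [x^q]
    divides [F - G].  As [F - G] has degree less than [q], it vanishes. *)

Local Open Scope ring_scope.
Import GRing.Theory.

Lemma mulS_central_bin k :
  (k.+1 * 'C(2 * k.+1, k.+1) = (4 * k + 2) * 'C(2 * k, k))%N.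
Proof.
have -> : (2 * k.+1 = (2 * k).+2)%N by lia.
have := mul_bin_diag (2 * k).+2 k; have := mul_bin_down (2 * k).+1 k.
have -> : ((2 * k).+1 - k = k.+1)%N by lia.
by move=> /= ? ?; nia.
Qed.

(** Writing [c_m] for the sum, the reflection [i -> m - i] gives
    [m c_m = 2 S_m], where [S_m] carries the extra weight [i].  The recurrence of
    the central binomial coefficients gives [S_(m+1) = 4 S_m + 2 c_m].  Together
    they yield [c_(m+1) = 4 c_m]: this is the differential equation
    [(1 - 4x) F' = 2 F] read on the coefficients of [F^2]. *)
Lemma sum_central_bin m :
  (\sum_(i < m.+1) 'C(2 * i, i) * 'C(2 * (m - i), m - i) = 4 ^ m)%N.
Proof.
pose a k := 'C(2 * k, k).
pose c n := (\sum_(i < n.+1) a i * a (n - i))%N.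
pose S n := (\sum_(i < n.+1) i * (a i * a (n - i)))%N.
rewrite -[LHS]/(c m).
have cS n : (n * c n = 2 * S n)%N.
  have -> : (2 * S n = S n + \sum_(i < n.+1) (n - i) * (a i * a (n - i)))%N.
    rewrite mul2n -addnn; congr (_ + _)%N.
    rewrite /S (reindex_inj rev_ord_inj) /=; apply: eq_bigr => i _.
    have le_in : (i <= n)%N by rewrite -ltnS.
    by rewrite subSS (subKn le_in) [(a i * _)%N]mulnC.
  rewrite -big_split /= big_distrr /=; apply: eq_bigr => i _.
  by rewrite -mulnDl subnKC // -ltnS.
have SS n : (S n.+1 = 4 * S n + 2 * c n)%N.
  rewrite {1}/S big_ord_recl mul0n add0n !big_distrr -big_split /=.
  apply: eq_bigr => i _; rewrite /bump /= add1n subSS mulnA.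
  by rewrite /a mulS_central_bin; ring.
elim: m => [|m IHm]; first by rewrite /c big_ord1.
by have := cS m; have := cS m.+1; have := SS m; rewrite expnS; nia.
Qed.

Section TruncatedSquareRoot.
Variable K : fieldType.
Implicit Types P Q : {poly K}.

Lemma dvdXn_coef n P : (forall i, (i < n)%N -> P`_i = 0) -> ('X^n %| P)%R.
Proof.
move=> P0; rewrite -(poly_take_drop n P).
suff -> : take_poly n P = 0 by rewrite add0r dvdp_mulIr.
by apply/polyP => i; rewrite coef_take_poly coef0; case: ifP => // /P0.
Qed.

(** A nonzero constant term makes [U] and [P + Q] prime to ['X], so that ['X^n]
    must divide the remaining factor [P - Q], whose degree is less than [n]. *)
Lemma truncated_sqrt_uniq n (U P Q : {poly K}) :
    (size P <= n)%N -> (size Q <= n)%N ->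
    U.[0] != 0 -> (P + Q).[0] != 0 ->
  ('X^n %| U * (P ^+ 2 - Q ^+ 2))%R -> P = Q.
Proof.
move=> sP sQ U0 PQ0 dvd.
have : ('X^n %| P - Q)%R.
  have coX V : V.[0] != 0 -> coprimep 'X^n V.
    by move=> V0; rewrite coprimep_expl // coprimep_sym coprimepX.
  move: dvd; rewrite Gauss_dvdpr ?coX // subr_sqr mulrC.
  by rewrite Gauss_dvdpr ?coX.
apply: contraTeq; rewrite -subr_eq0 => nz; apply/negP => /(dvdp_leq nz).
rewrite size_polyXn leqNgt ltnS (leq_trans (size_polyD _ _)) //.
by rewrite size_polyN geq_max sP sQ.
Qed.

End TruncatedSquareRoot.

(** Coefficients of [F^2] below [X^n] only involve those of [F] below [X^n], so
    truncation is harmless there and they are the powers of [4] found above. *)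
Lemma central_bin_poly_sqr (K : fieldType) n :
  (('X^n : {poly K})
    %| (1 - 4%:R *: 'X) * (\poly_(k < n) ('C(2 * k, k))%:R) ^+ 2 - 1)%R.
Proof.
set F := \poly_(k < n) _; apply: dvdXn_coef => i lt_in.
have F2 j : (j < n)%N -> (F ^+ 2)`_j = (4 ^ j)%:R.
  move=> lt_jn; rewrite expr2 coefM -sum_central_bin natr_sum.
  apply: eq_bigr => k _; rewrite !coef_poly natrM.
  by rewrite !ifT //; have := ltn_ord k; lia.
rewrite mulrBl mul1r -scalerAl !coefB coefZ coefXM coef1 F2 //.
case: i lt_in => [|i] lt_in /=; first by rewrite mulr0 subr0 subrr.
by rewrite F2 ?(ltnW lt_in) // expnS natrM subrr subr0.
Qed.

(** [L] being [1 - 4x], both sides are square roots of [1 / L] modulo ['X^q], with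
    constant term [1]; as [p] is odd, [1 + 1] is nonzero and they coincide. *)
Lemma central_bin_poly_pchar (K : fieldType) (p s : nat) :
    p \in [pchar K] -> odd p ->
  \poly_(k < p ^ s) ('C(2 * k, k))%:R
    = (1 - 4%:R *: 'X) ^+ ((p ^ s - 1) %/ 2) :> {poly K}.
Proof.
move=> chKp p_odd; set q := (p ^ s)%N; set n := ((q - 1) %/ 2)%N.
have p_prime := pcharf_prime chKp.
have q_odd : odd q by rewrite /q oddX p_odd orbT.
have q_gt0 : (0 < q)%N by rewrite expn_gt0 prime_gt0.
have q_n : q = (n * 2).+1 by rewrite /n; lia.
set F := \poly_(k < q) _; pose L : {poly K} := 1 - 4%:R *: 'X.
have L0 : L.[0] = 1 by rewrite /L !hornerE ?mulr0 ?subr0.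
have F0 : F.[0] = 1 by rewrite horner_coef0 coef_poly q_gt0.
rewrite -/L; apply: (truncated_sqrt_uniq _ q L).
- exact: size_poly.
- apply: leq_trans (size_poly_exp_leq _ _) _.
  have: (size L <= 2)%N.
    rewrite (leq_trans (size_polyD _ _)) // size_poly1 size_polyN geq_max /=.
    by rewrite (leq_trans (size_scale_leq _ _)) // size_polyX.
  by move=> sL; rewrite q_n; nia.
- by rewrite L0 oner_eq0.
- rewrite hornerD F0 horner_exp L0 expr1n -[1 + 1]/(2%:R).
  by rewrite -(dvdn_pcharf chKp) dvdn_prime2 //; apply: contraL p_odd => /eqP->.
have LG : L * (L ^+ n) ^+ 2 = 1 - 4%:R ^+ q *: 'X^q.
  rewrite -exprM -exprS -q_n /L.
  have qnat : [pchar {poly K}].-nat q.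
    by rewrite pnatX; apply/orP; left; rewrite pnatE // pchar_poly.
  by rewrite exprDn_pchar // exprNn_pchar // expr1n exprZn.
have -> : L * (F ^+ 2 - (L ^+ n) ^+ 2) = (L * F ^+ 2 - 1) + 4%:R ^+ q *: 'X^q.
  by rewrite mulrBr LG opprB addrA addrAC.
by rewrite dvdp_add ?central_bin_poly_sqr // -mul_polyC dvdp_mulIr.
Qed.

Lemma eqpoly_mod_pchar (R : nzRingType) (p : nat) (f g : {poly int}) :
    p \in [pchar R] ->
  map_poly (intr : int -> R) f = map_poly intr g -> eqpoly_mod p f g.
Proof.
move=> chRp /polyP fg i; apply/eqP; rewrite eqz_mod_dvd (dvdz_pcharf chRp).
by have := fg i; rewrite !coef_map rmorphB /= => ->; rewrite subrr.
Qed.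

Theorem theorem3 (p q s : nat) (p_prime : prime p) (p_odd : odd p)
    (s_ge1 : (1 <= s)%N) (q_def : q = (p ^ s)%N) :
  eqpoly_mod p
    (\sum_(0 <= k < q) ('C(2 * k, k)%N)%:Z *: 'X^k)
    ((1 - 4%:Z *: 'X) ^+ ((q - 1) %/ 2)%N).
Proof.
have chp := pchar_Fp p_prime.
apply: (eqpoly_mod_pchar _ _ _ _ chp).
rewrite rmorphXn rmorphB rmorph1 /= map_polyZ map_polyX /=.
rewrite q_def -[RHS](central_bin_poly_pchar _ _ s chp p_odd).
rewrite rmorph_sum poly_def big_mkord; apply: eq_bigr => k _.
by rewrite /= map_polyZ map_polyXn.
Qed.
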